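(* Let $\alpha,\beta,\gamma\in\mathbb{R}$ with $\alpha\neq 0$. Then the difference equation on $\mathbb{R}$ $$y_{n+1}=\alpha|y_n|+\beta y_n+\gamma y_{n-1}$$ is topologically conjugate to the max-type difference equation on $(0,\infty)$ $$z_{n+1}=\frac{\max\{z_n^{2\alpha},B\}}{z_n^{\alpha-\beta}\cdot z_{n-1}^{-\gamma}}\cdot B^{\frac{\alpha+\beta+\gamma-1}{-2\alpha}}$$ for all $B>0$. In particular, if $\alpha+\beta+\gamma-1=0$, then it is topologically conjugate to $$z_{n+1}=\frac{\max\{z_n^{2\alpha},B\}}{z_n^{\alpha-\beta}\cdot z_{n-1}^{-\gamma}}$$ for all $B>0$.
   Context: To a second-order difference equation $x_{n+1}=f(x_n,x_{n-1})$ on a topological space $X$ one associates the discrete dynamical system $(X^2,F)$ with $F(x,y)=(y,f(y,x))$. Two continuous maps $\varphi:X\to X$ and $\psi:Y\to Y$ are topologically conjugate if there is a homeomorphism $\phi:X\to Y$ with $\phi\circ\varphi=\psi\circ\phi$. Two difference equations are topologically conjugate if their associated dynamical systems are. Here the equation in $y_n$ is considered with arbitrary real initial conditions ($X=\mathbb{R}$), and the equations in $z_n$ with arbitrary positive initial conditions ($X=(0,\infty)$). *)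

(* Defs.v *)
From HB Require Import structures.
From mathcomp Require Import all_boot all_order all_algebra.
From mathcomp Require Import all_classical all_reals all_analysis.

Set Implicit Arguments.
Unset Strict Implicit.
Unset Printing Implicit Defensive.

Import Order.TTheory GRing.Theory Num.Theory.
Import numFieldNormedType.Exports.

Local Open Scope classical_set_scope.
Local Open Scope ring_scope.

Definition homeomorphism (X Y : topologicalType) (h : X -> Y) : Prop :=
  continuous h /\
  exists g : Y -> X, [/\ continuous g, cancel h g & cancel g h].

(* Conjugacy is a relation between continuous self-maps, so the continuity of
   both maps is part of it. *)
Definition topologically_conjugate (X Y : topologicalType)
    (phi : X -> X) (psi : Y -> Y) : Prop :=
  [/\ continuous phi, continuous psi &
      exists2 h : X -> Y, homeomorphism h & h \o phi =1 psi \o h].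

(* [f] gives x_(n+1) = f x_n x_(n-1); the state of the system is the pair
   (x_(n-1), x_n). *)
Definition associated_map (X : Type) (f : X -> X -> X) (p : X * X) : X * X :=
  (p.2, f p.2 p.1).

Definition conjugate_equations (X Y : topologicalType)
    (f : X -> X -> X) (g : Y -> Y -> Y) : Prop :=
  topologically_conjugate (associated_map f) (associated_map g).

(* Coerced to a type, this set carries the subspace topology. *)
Definition positive_reals (R : realType) : set R := [set x | 0 < x].
Arguments positive_reals : clear implicits.

Lemma positive_realsP (R : realType) (x : positive_reals R) : 0 < \val x.
Proof. exact: set_mem (valP x). Qed.

Definition restrict_positive (R : realType) (f : R -> R -> R)
    (f_gt0 : forall x y : R, 0 < x -> 0 < y -> 0 < f x y)
    (x y : positive_reals R) : positive_reals R :=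
  exist _ (f (\val x) (\val y))
    (mem_set (f_gt0 _ _ (positive_realsP x) (positive_realsP y))).

Lemma max_type_gt0 (R : realType) (alpha beta gamma B : R) (hB : 0 < B)
    (x y : R) : 0 < x -> 0 < y ->
  0 < Num.max (x `^ (2 * alpha)) B / (x `^ (alpha - beta) * y `^ (- gamma)).
Proof.
by move=> x0 y0; rewrite divr_gt0 ?mulr_gt0 ?powR_gt0// lt_max hB orbT.
Qed.

Lemma scaled_max_type_gt0 (R : realType) (alpha beta gamma B : R) (hB : 0 < B)
    (x y : R) : 0 < x -> 0 < y ->
  0 < Num.max (x `^ (2 * alpha)) B / (x `^ (alpha - beta) * y `^ (- gamma))
      * B `^ ((alpha + beta + gamma - 1) / (- 2 * alpha)).
Proof. by move=> x0 y0; rewrite mulr_gt0 ?powR_gt0 ?max_type_gt0. Qed.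

(* Main.v *)
Require Import Defs.
From HB Require Import structures.
From mathcomp Require Import all_boot all_order all_algebra.
From mathcomp Require Import all_classical all_reals all_analysis.
From mathcomp Require Import ring.

Set Implicit Arguments.
Unset Strict Implicit.
Unset Printing Implicit Defensive.

Import Order.TTheory GRing.Theory Num.Theory.
Import numFieldNormedType.Exports.

Local Open Scope classical_set_scope.
Local Open Scope ring_scope.

(* In the coordinate [w = ln z] the max-type equation becomes
   [w_(n+1) = max (2 alpha w_n) (ln B) - (alpha - beta) w_n + gamma w_(n-1) + const].
   Since [max (2 u) 0 = u + |u|], shifting by [ln B / (2 alpha)] cancels the
   constant and leaves [|alpha| |w_n| + beta w_n + gamma w_(n-1)]; the
   substitution [w = alpha * y] then turns [|alpha|] into [alpha] whatever the
   sign of [alpha]. The conjugacy is thus, in each coordinate,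
   [y |-> exp (alpha * y + ln B / (2 alpha))]. *)

Lemma homeomorphism_pair (X Y : topologicalType) (h : X -> Y) :
  homeomorphism h ->
  homeomorphism (fun p : X * X => (h p.1, h p.2)).
Proof.
have pair_cts (U V : topologicalType) (k : U -> V) : continuous k ->
    continuous (fun p : U * U => (k p.1, k p.2)).
  move=> k_cts p; apply: cvg_pair => /=.
    by apply: (@continuous_comp _ _ _ fst k); [exact: cvg_fst|exact: k_cts].
  by apply: (@continuous_comp _ _ _ snd k); [exact: cvg_snd|exact: k_cts].
move=> [h_cts [g [g_cts hK gK]]]; split; first exact: pair_cts.
exists (fun p => (g p.1, g p.2)); split; first exact: pair_cts.
- by move=> [x y] /=; rewrite !hK.
- by move=> [x y] /=; rewrite !gK.
Qed.

(** Continuity of [psi] comes for free, since [psi] is [phi] transported along [h]. Thus the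
    max-type map on positive pairs never needs a direct continuity proof. *)
Lemma topologically_conjugate_homeo (X Y : topologicalType)
    (phi : X -> X) (psi : Y -> Y) (h : X -> Y) :
  continuous phi -> homeomorphism h -> h \o phi =1 psi \o h ->
  topologically_conjugate phi psi.
Proof.
move=> phi_cts h_homeo comm; split => //; last by exists h.
have [h_cts [g [g_cts hK gK]]] := h_homeo.
have -> : psi = h \o (phi \o g).
  by apply/funext => y; rewrite -[in LHS](gK y) -[LHS]comm.
move=> y; apply: continuous_comp; last exact: h_cts.
by apply: continuous_comp; [exact: g_cts|exact: phi_cts].
Qed.

(** Applying [h] in both coordinates respects the shift coordinate of the associated maps
    automatically, so only the recurrences themselves have to be intertwined. *)
Lemma conjugate_equations_homeo (X Y : topologicalType)
    (f : X -> X -> X) (g : Y -> Y -> Y) (h : X -> Y) :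
  continuous (fun p : X * X => f p.2 p.1) -> homeomorphism h ->
  (forall x x', h (f x x') = g (h x) (h x')) ->
  conjugate_equations f g.
Proof.
move=> f_cts h_homeo comm.
apply: (topologically_conjugate_homeo _ (homeomorphism_pair h_homeo)).
  by move=> p; apply: cvg_pair => /=; [exact: cvg_snd|exact: f_cts].
by move=> [x x']; rewrite /associated_map /= comm.
Qed.

Definition exp_affine (R : realType) (a c y : R) : positive_reals R :=
  exist _ (expR (a * y + c)) (mem_set (expR_gt0 (a * y + c))).

Lemma homeomorphism_exp_affine (R : realType) (a c : R) :
  a != 0 -> homeomorphism (@exp_affine R a c).
Proof.
move=> a0; split.
  (* The subspace topology is initial for [\val], so it suffices to treat the underlying real-valued
     map. *)
  apply: continuous_comp_initial => y.
  apply: (@continuous_comp _ _ _ (fun y => a * y + c) expR) => /=;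
    last exact: continuous_expR.
  by apply: cvgD; [apply: cvgM; [exact: cvg_cst|exact: cvg_id]|exact: cvg_cst].
exists (fun z : positive_reals R => (ln (\val z) - c) / a); split.
- move=> z.
  apply: (@continuous_comp _ _ _ (\val : positive_reals R -> R)
    (fun t => (ln t - c) / a)); first exact: initial_continuous.
  apply: cvgM; last exact: cvg_cst.
  apply: cvgB; last exact: cvg_cst.
  by apply: continuous_ln; exact: positive_realsP.
- by move=> y /=; rewrite expRK addrK mulrC mulKf.
- move=> z; apply: val_inj => /=.
  by rewrite mulrC divfK// subrK lnK// posrE positive_realsP.
Qed.

Lemma absolute_value_map_continuous (R : realType) (alpha beta gamma : R) :
  continuous (fun p : R * R => alpha * `|p.2| + beta * p.2 + gamma * p.1).
Proof.
move=> p; apply: cvgD; [apply: cvgD|].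
- apply: cvgM; first exact: cvg_cst.
  by apply: cvg_norm; exact: cvg_snd.
- by apply: cvgM; [exact: cvg_cst|exact: cvg_snd].
- by apply: cvgM; [exact: cvg_cst|exact: cvg_fst].
Qed.

Lemma expR_max (R : realType) (x y : R) :
  expR (Num.max x y) = Num.max (expR x) (expR y).
Proof. by rewrite !maxEle ler_expR; case: ifP. Qed.

Lemma max_double0 (R : realDomainType) (u : R) : Num.max (2 * u) 0 = u + `|u|.
Proof.
(* With 0 written as [u - u], a summand [u] leaves the maximum, and [max u (- u)] remains. *)
by rewrite -[X in Num.max _ X](addrN u) mulr_natl mulr2n -addr_maxr maxrN.
Qed.

Lemma exp_affine_max_type (R : realType) (alpha beta gamma B : R) (y y' : R) :
  alpha != 0 -> 0 < B ->
  let h x := expR (alpha * x + ln B / (2 * alpha)) in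
  h (alpha * `|y| + beta * y + gamma * y') =
  Num.max (h y `^ (2 * alpha)) B / (h y `^ (alpha - beta) * h y' `^ (- gamma))
    * B `^ ((alpha + beta + gamma - 1) / (- 2 * alpha)).
Proof.
move=> alpha0 B0 /=.
have -> : B `^ ((alpha + beta + gamma - 1) / (- 2 * alpha)) =
    expR ((alpha + beta + gamma - 1) / (- 2 * alpha) * ln B).
  by rewrite -[in LHS](lnK B0) -expRM mulrC.
rewrite -[X in Num.max _ X](lnK B0) -!expRM -expR_max -expRD -expRN -!expRD.
congr expR.
(* Pull [ln B] out of the maximum and put [u = alpha ^+ 2 * y]. As the square is nonnegative, it
   leaves the absolute value whatever the sign of [alpha]. *)
have -> : Num.max ((alpha * y + ln B / (2 * alpha)) * (2 * alpha)) (ln B) =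
    alpha ^+ 2 * y + alpha ^+ 2 * `|y| + ln B.
  have -> : (alpha * y + ln B / (2 * alpha)) * (2 * alpha) =
      2 * (alpha ^+ 2 * y) + ln B by field.
  rewrite -[X in Num.max _ X]add0r -addr_maxl max_double0 normrM.
  by rewrite ger0_norm// sqr_ge0.
(* The coefficients of [ln B / (2 * alpha)] on the right add up to [2 * alpha - (alpha - beta) +
   gamma - (alpha + beta + gamma - 1) = 1], matching the shift on the left. *)
by field.
Qed.

Theorem proposition1 (R : realType) (alpha beta gamma : R)
    (alpha_neq0 : alpha != 0) :
  (forall (B : R) (hB : 0 < B),
     @conjugate_equations R (positive_reals R)
       (fun y y' : R => alpha * `|y| + beta * y + gamma * y')
       (@restrict_positive R
          (fun z z' : R =>
             Num.max (z `^ (2 * alpha)) B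
               / (z `^ (alpha - beta) * z' `^ (- gamma))
               * B `^ ((alpha + beta + gamma - 1) / (- 2 * alpha)))
          (scaled_max_type_gt0 alpha beta gamma hB)))
  /\
  (alpha + beta + gamma - 1 = 0 ->
   forall (B : R) (hB : 0 < B),
     @conjugate_equations R (positive_reals R)
       (fun y y' : R => alpha * `|y| + beta * y + gamma * y')
       (@restrict_positive R
          (fun z z' : R =>
             Num.max (z `^ (2 * alpha)) B
               / (z `^ (alpha - beta) * z' `^ (- gamma)))
          (max_type_gt0 alpha beta gamma hB))).
Proof.
split=> [B hB|sum1 B hB];
  apply: (conjugate_equations_homeo (@absolute_value_map_continuous _ _ _ _)
    (homeomorphism_exp_affine (ln B / (2 * alpha)) alpha_neq0)) => y y';
  apply: val_inj => /=.
- exact: exp_affine_max_type.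
(* Here the scaling factor is [B] to the power 0, so the same conjugacy serves. *)
- by rewrite (exp_affine_max_type _ _ _ _ alpha_neq0 hB) sum1 mul0r powRr0 mulr1.
Qed.
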